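(* The class $\mathcal{S}$ of square roots of Thompson's group $F$ contains uncountably many distinct isomorphism types of groups.
   Context: Let $I=[0,1]$ and let $\mathrm{Homeo}^+(I)$ be the group of orientation-preserving homeomorphisms of $I$. For a homeomorphism $f$, $\operatorname{supp} f=\{x : f(x)\neq x\}$. Two nonempty open intervals $J_1,J_2$ form a two-chain if $J_1\cap J_2$ is a nonempty proper subinterval of $J_1$ and of $J_2$. Thompson's group is $F\cong\langle A,B\mid [A,(AB)^{-1}B(AB)],\ [A,(AB)^{-2}B(AB)^2]\rangle$. A square root of $F$ is a two-generated subgroup $\langle f,g\rangle<\mathrm{Homeo}^+(I)$ such that $\langle f^2,g^2\rangle\cong F$ and such that $\operatorname{supp} f$ and $\operatorname{supp} g$ are open intervals forming a two-chain. $\mathcal{S}$ denotes the set of isomorphism classes (as abstract groups) of square roots of $F$. *)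

(* Defs.v *)
From HB Require Import structures.
From Stdlib Require Import Relations.Relation_Operators.
From mathcomp Require Import all_boot all_order all_algebra.
From mathcomp Require Import all_classical all_reals all_analysis.

Set Implicit Arguments.
Unset Strict Implicit.
Unset Printing Implicit Defensive.

Import Order.TTheory GRing.Theory Num.Theory.
Import numFieldNormedType.Exports.

Local Open Scope classical_set_scope.
Local Open Scope group_scope.

Section Subgroups.
Variables G H : groupType.

Definition generated (X : set G) : set G :=
  smallest [set K : set G | group_closed (mem K)] X.

(* A subgroup is represented by its underlying set; the values of [phi]
   outside [A] are irrelevant. *)
Definition isomorphic (A : set G) (B : set H) : Prop :=
  exists phi : G -> H,
    set_bij A B phi /\ (forall x y, A x -> A y -> phi (x * y) = phi x * phi y).

End Subgroups.

Section Presentations.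
Variable X : choiceType.

(* The letter [(x, false)] is the generator [x], and [(x, true)] is its formal
   inverse. *)
Definition word : Type := seq (X * bool).

Definition letter_inv (l : X * bool) : X * bool := (l.1, ~~ l.2).

Definition word_inv (w : word) : word := rev (map letter_inv w).

Definition word_comm (u v : word) : word :=
  word_inv u ++ word_inv v ++ u ++ v.

Variable rels : set word.

Inductive pres_step : word -> word -> Prop :=
  | step_cancel u v l : pres_step (u ++ [:: l; letter_inv l] ++ v) (u ++ v)
  | step_rel u v r : rels r -> pres_step (u ++ r ++ v) (u ++ v).

Definition pres_equiv : word -> word -> Prop :=
  clos_refl_sym_trans word pres_step.

Definition pres_rel : rel word := fun u v => `[< pres_equiv u v >].

Lemma pres_rel_refl : reflexive pres_rel.
Proof. by move=> u; apply/asboolP/rst_refl. Qed.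

Lemma pres_rel_sym : symmetric pres_rel.
Proof. by move=> u v; apply: asbool_equiv_eq; split; apply: rst_sym. Qed.

Lemma pres_rel_trans : transitive pres_rel.
Proof.
by move=> v u w /asboolP uv /asboolP vw; apply/asboolP/(rst_trans _ _ _ v).
Qed.

Canonical pres_equiv_rel :=
  EquivRel pres_rel pres_rel_refl pres_rel_sym pres_rel_trans.

Definition presented : Type := {eq_quot pres_rel}%qT.

HB.instance Definition _ := Choice.on presented.
HB.instance Definition _ := EqQuotient.on presented.

Local Open Scope quotient_scope.

Lemma pres_eqP (u v : word) :
  \pi_presented u = \pi_presented v <-> pres_equiv u v.
Proof.
split; first by move/eqP; rewrite piE => /asboolP.
by move=> uv; apply/eqP; rewrite piE; apply/asboolP.
Qed.

Lemma pres_equiv_catl w u v :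
  pres_equiv u v -> pres_equiv (w ++ u) (w ++ v).
Proof.
elim=> [_ _ [u' v' l|u' v' r Rr]|u'|u' v' _|u' v' w' _ + _].
- by apply: rst_step; rewrite !(catA w); exact: step_cancel.
- by apply: rst_step; rewrite !(catA w); exact: step_rel.
- exact: rst_refl.
- exact: rst_sym.
- exact: rst_trans.
Qed.

Lemma pres_equiv_catr w u v :
  pres_equiv u v -> pres_equiv (u ++ w) (v ++ w).
Proof.
elim=> [_ _ [u' v' l|u' v' r Rr]|u'|u' v' _|u' v' w' _ + _].
- by apply: rst_step; rewrite -!catA; exact: step_cancel.
- by apply: rst_step; rewrite -!catA; exact: step_rel.
- exact: rst_refl.
- exact: rst_sym.
- exact: rst_trans.
Qed.

Lemma letter_invK : involutive letter_inv.
Proof. by case=> x b; rewrite /letter_inv /= negbK. Qed.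

Lemma word_invK : involutive word_inv.
Proof.
move=> w; rewrite /word_inv map_rev revK -map_comp.
by rewrite (eq_map (g := id)) ?map_id // => l; exact: letter_invK.
Qed.

Lemma word_mulV w : pres_equiv (w ++ word_inv w) [::].
Proof.
elim: w => [|l w IHw]; first exact: rst_refl.
rewrite /word_inv /= rev_cons -cats1.
apply: (rst_trans _ _ _ ([:: l] ++ [::] ++ [:: letter_inv l])).
  rewrite -cat1s; apply: pres_equiv_catl.
  by rewrite catA; apply: pres_equiv_catr.
by apply: rst_step; exact: (@step_cancel [::] [::] l).
Qed.

Lemma word_mul1V w : pres_equiv (word_inv w ++ w) [::].
Proof. by rewrite -{2}(word_invK w); exact: word_mulV. Qed.

Lemma word_inv_cat u v : word_inv (u ++ v) = word_inv v ++ word_inv u.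
Proof. by rewrite /word_inv map_cat rev_cat. Qed.

Lemma pres_equiv_inv u v :
  pres_equiv u v -> pres_equiv (word_inv u) (word_inv v).
Proof.
move=> uv; apply: (rst_trans _ _ _ (word_inv u ++ (v ++ word_inv v))).
  have := pres_equiv_catl (word_inv u) (rst_sym _ _ _ _ (word_mulV v)).
  by rewrite cats0.
rewrite catA; apply: (pres_equiv_catr (word_inv v) (v := [::])).
apply: (rst_trans _ _ _ (word_inv u ++ u)); last exact: word_mul1V.
exact/pres_equiv_catl/rst_sym.
Qed.

Definition pres_one : presented := \pi_presented [::].
Definition pres_mul (x y : presented) : presented :=
  \pi_presented (repr x ++ repr y).
Definition pres_inv (x : presented) : presented :=
  \pi_presented (word_inv (repr x)).

Lemma pres_repr u : pres_equiv (repr (\pi_presented u)) u.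
Proof. by apply/pres_eqP; rewrite reprK. Qed.

Lemma pres_mul_pi u v :
  pres_mul (\pi_presented u) (\pi_presented v) = \pi_presented (u ++ v).
Proof.
apply/pres_eqP; apply: (rst_trans _ _ _ (u ++ repr (\pi_presented v))).
  exact/pres_equiv_catr/pres_repr.
exact/pres_equiv_catl/pres_repr.
Qed.

Lemma pres_inv_pi u :
  pres_inv (\pi_presented u) = \pi_presented (word_inv u).
Proof. exact/pres_eqP/pres_equiv_inv/pres_repr. Qed.

Lemma presented_ind (P : presented -> Prop) :
  (forall u, P (\pi_presented u)) -> forall x, P x.
Proof. by move=> Ppi x; rewrite -[x]reprK. Qed.

Lemma pres_mulA : associative pres_mul.
Proof.
elim/presented_ind=> u; elim/presented_ind=> v; elim/presented_ind=> w.
by rewrite !pres_mul_pi catA.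
Qed.

Lemma pres_mul1 : left_id pres_one pres_mul.
Proof. by elim/presented_ind=> u; rewrite /pres_one pres_mul_pi. Qed.

Lemma pres_mulr1 : right_id pres_one pres_mul.
Proof. by elim/presented_ind=> u; rewrite /pres_one pres_mul_pi cats0. Qed.

Lemma pres_mulVx : left_inverse pres_one pres_inv pres_mul.
Proof.
elim/presented_ind=> u; rewrite pres_inv_pi pres_mul_pi.
exact/pres_eqP/word_mul1V.
Qed.

Lemma pres_mulxV : right_inverse pres_one pres_inv pres_mul.
Proof.
elim/presented_ind=> u; rewrite pres_inv_pi pres_mul_pi.
exact/pres_eqP/word_mulV.
Qed.

HB.instance Definition _ := isGroup.Build presented
  pres_mulA pres_mul1 pres_mulr1 pres_mulVx pres_mulxV.

End Presentations.

Definition letterA : word bool := [:: (false, false)].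
Definition letterB : word bool := [:: (true, false)].
Definition wordAB : word bool := letterA ++ letterB.

(* The relators [A, (AB)^-1 B (AB)] and [A, (AB)^-2 B (AB)^2]; each says that
   two words commute, so the commutator convention does not matter. *)
Definition thompson_rels : set (word bool) :=
  [set word_comm letterA (word_inv wordAB ++ letterB ++ wordAB);
       word_comm letterA (word_inv (wordAB ++ wordAB) ++ letterB ++
                          (wordAB ++ wordAB))].

Definition thompsonF : groupType := presented thompson_rels.

Section HomeoI.
Variable R : realType.

Definition unitI : Type := set_type `[0%R, 1%R : R]%classic.
HB.instance Definition _ := Topological.on unitI.

(* Orientation-preserving homeomorphisms of [0, 1] for its subspace topology,
   bundled with their inverse. The group law below is composition. *)
Record homeoI := HomeoI {
  homeo_fun :> unitI -> unitI;
  homeo_inv : unitI -> unitI;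
  homeo_funK : cancel homeo_fun homeo_inv;
  homeo_invK : cancel homeo_inv homeo_fun;
  homeo_fun_continuous : continuous homeo_fun;
  homeo_inv_continuous : continuous homeo_inv;
  homeo_increasing :
    forall x y : unitI,
      (set_val x < set_val y)%R ->
      (set_val (homeo_fun x) < set_val (homeo_fun y))%R
}.

HB.instance Definition _ := gen_eqMixin homeoI.
HB.instance Definition _ := gen_choiceMixin homeoI.

Lemma homeoI_eq (f g : homeoI) : homeo_fun f = homeo_fun g -> f = g.
Proof.
case: f g => [f f' fK f'K fc f'c fi] [g g' gK g'K gc g'c gi] /= fg.
subst g; have e : f' = g'.
  by apply/funext => x; rewrite -[x in LHS]g'K fK.
by subst g'; congr HomeoI; exact: Prop_irrelevance.
Qed.

Lemma homeo_inv_increasing (f : homeoI) (x y : unitI) :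
  (set_val x < set_val y)%R ->
  (set_val (homeo_inv f x) < set_val (homeo_inv f y))%R.
Proof.
move=> xy; case: ltgtP => // [yx|e].
- by have := homeo_increasing f yx; rewrite !homeo_invK ltNge (ltW xy).
- have /(congr1 (homeo_fun f)) : homeo_inv f x = homeo_inv f y.
    by apply: val_inj; exact: e.
  by rewrite !homeo_invK => exy; rewrite exy ltxx in xy.
Qed.

Definition homeoI_one : homeoI.
Proof.
refine (@HomeoI id id _ _ _ _ _) => //.
- by move=> x; exact: cvg_id.
- by move=> x; exact: cvg_id.
Defined.

Definition homeoI_mul (f g : homeoI) : homeoI.
Proof.
refine (@HomeoI (homeo_fun f \o homeo_fun g) (homeo_inv g \o homeo_inv f)
  _ _ _ _ _).
- exact: can_comp (homeo_funK f) (homeo_funK g).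
- exact: can_comp (homeo_invK g) (homeo_invK f).
- move=> x; apply: continuous_comp; exact: homeo_fun_continuous.
- move=> x; apply: continuous_comp; exact: homeo_inv_continuous.
- by move=> x y xy; do 2! apply: homeo_increasing.
Defined.

Definition homeoI_inv (f : homeoI) : homeoI :=
  HomeoI (homeo_invK f) (homeo_funK f) (@homeo_inv_continuous f)
    (@homeo_fun_continuous f) (@homeo_inv_increasing f).

Lemma homeoI_mulA : associative homeoI_mul.
Proof. by move=> f g h; exact: homeoI_eq. Qed.

Lemma homeoI_mul1 : left_id homeoI_one homeoI_mul.
Proof. by move=> f; exact: homeoI_eq. Qed.

Lemma homeoI_mulr1 : right_id homeoI_one homeoI_mul.
Proof. by move=> f; exact: homeoI_eq. Qed.

Lemma homeoI_mulV : left_inverse homeoI_one homeoI_inv homeoI_mul.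
Proof.
by move=> f; apply: homeoI_eq; apply/funext => x /=; exact: homeo_funK.
Qed.

Lemma homeoI_mulrV : right_inverse homeoI_one homeoI_inv homeoI_mul.
Proof.
by move=> f; apply: homeoI_eq; apply/funext => x /=; exact: homeo_invK.
Qed.

HB.instance Definition _ := isGroup.Build homeoI
  homeoI_mulA homeoI_mul1 homeoI_mulr1 homeoI_mulV homeoI_mulrV.

(* The support is seen as a subset of the real line; since orientation-preserving
   homeomorphisms of [0, 1] fix both endpoints, being an open interval of [0, 1]
   or of the line is the same for it. *)
Definition supp (f : homeoI) : set R := set_val @` [set x : unitI | f x <> x].

Definition open_interval (J : set R) : Prop :=
  exists a b : R, (a < b)%R /\ J = `]a, b[%classic.

Definition two_chain (J1 J2 : set R) : Prop :=
  [/\ open_interval J1, open_interval J2,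
      J1 `&` J2 !=set0, is_interval (J1 `&` J2) &
      J1 `&` J2 `<` J1 /\ J1 `&` J2 `<` J2].

Definition square_root_of_F (K : set homeoI) : Prop :=
  exists f g : homeoI,
    [/\ K = generated [set f; g],
        isomorphic (generated [set f ^+ 2; g ^+ 2]) [set: thompsonF] &
        two_chain (supp f) (supp g)].

(* Isomorphism as abstract groups, among the square roots of F. *)
Definition iso_class (K : set homeoI) : set (set homeoI) :=
  [set L | square_root_of_F L /\ isomorphic K L].

Definition square_root_classes : set (set (set homeoI)) :=
  [set iso_class K | K in square_root_of_F].

End HomeoI.

Arguments square_root_classes R : clear implicits.

(* Main.v *)
(** Let [f] and [g] move every point of their supports [(0, s)] and [(r, 1)]
    down, with [f^2 g^2 (s) <= r].  Then [a = f^2] and [b = g^2] satisfy the two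
    relations of F, because conjugating [b] by [ab] pushes its support off that
    of [a].  Every element of F is a fraction of sorted positive words in
    [x_0 = ab], [x_(n+1) = (ab)^-n b (ab)^n]; these act with supports
    [(r_n, 1)], where [r_n] increases, so distinct sorted words act differently
    and [<a, b>] is F.

    As a countable group has countably many generating pairs, it suffices to
    find uncountably many such pairs [(f_e, g)] with distinct sets of relators.
    Take elements [u] and [v] of [<f_e, g>] with supports [(0, p)] and
    [(q, 1)], where [p = f_e^-1 g^2 (s)] and [q] is in the orbit of [r]: they
    commute if and only if [p <= q].  We perturb [f_e] so that [p] is strictly
    increasing in [e], while a set of orbit points [q] that is dense in
    [[r, s]] does not depend on [e].  So the relators determine [e]. *)

From Stdlib Require Import Relations.Relation_Operators.
Require Import Defs.
From mathcomp Require Import all_boot all_order all_algebra.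
From mathcomp Require Import all_classical all_reals all_analysis.
From mathcomp Require Import lra.

Set Implicit Arguments.
Unset Strict Implicit.
Unset Printing Implicit Defensive.

Import Order.TTheory GRing.Theory Num.Theory.
Import numFieldNormedType.Exports.

Local Open Scope quotient_scope.
Local Open Scope classical_set_scope.
Local Open Scope group_scope.

(** * Words and the infinite presentation of F *)

Definition weval (G : groupType) (a b : G) (w : word bool) : G :=
  foldr (fun (l : bool * bool) x =>
    (if l.2 then (if l.1 then b else a)^-1 else if l.1 then b else a) * x) 1 w.

Section WordEvaluation.
Variable G : groupType.
Implicit Types (a b : G) (v w : word bool).

Lemma weval_cat a b v w : weval a b (v ++ w) = weval a b v * weval a b w.
Proof. by elim: v => [|l v IHv] /=; rewrite ?mul1g // IHv mulgA. Qed.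

Lemma weval_inv a b w : weval a b (word_inv w) = (weval a b w)^-1.
Proof.
elim: w => [|[i s] w IHw]; first by rewrite invg1.
rewrite -cat1s word_inv_cat !weval_cat IHw invgM; congr (_ * _).
by case: s; rewrite /= !mulg1 ?invgK.
Qed.

Lemma weval_comm a b v w :
  weval a b (word_comm v w) = 1 <->
  weval a b v * weval a b w = weval a b w * weval a b v.
Proof.
rewrite /word_comm !weval_cat !weval_inv; split => [e|->].
  by rewrite -[RHS]mulg1 -e !mulgA mulgK mulgV mul1g.
by rewrite !mulgA mulgVK mulVg.
Qed.

Lemma generated2E a b : generated [set a; b] = range (weval a b).
Proof.
apply/seteqP; split => [x|_ [w _ <-] K [[K1 KD] abK]].
  apply; split; last first.
    by move=> _ [] ->; [exists letterA | exists letterB] => //=; rewrite mulg1.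
  split; first by apply/mem_set; exists [::].
  move=> _ _ /set_mem[v _ <-] /set_mem[w _ <-]; apply/mem_set.
  by exists (v ++ word_inv w); rewrite // weval_cat weval_inv.
have KV : forall x, K x -> K x^-1.
  by move=> x Kx; apply/set_mem; rewrite -[_^-1]mul1g; apply: KD => //; exact/mem_set.
have KM : forall x y, K x -> K y -> K (x * y).
  move=> x y Kx Ky; apply/set_mem; rewrite -[y]invgK.
  by apply: KD; apply/mem_set => //; exact: KV.
elim: w => [|[i s] w IHw] /=; first exact: set_mem K1.
apply: KM => //; case: s; [apply: KV|]; apply: abK; case: i; by [left|right].
Qed.

End WordEvaluation.

(** As [phi] is multiplicative only on [A], that it respects 1 and inverses is derived by
    cancellation, at values of words, which all lie in [A]. *)
Lemma weval_morph (G H : groupType) (A : set G) (phi : G -> H) (a b : G) :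
  range (weval a b) `<=` A ->
  (forall x y, A x -> A y -> phi (x * y) = phi x * phi y) ->
  forall w, phi (weval a b w) = weval (phi a) (phi b) w.
Proof.
move=> wA phiM.
have Aw w : A (weval a b w) by apply: wA; exists w.
have phi1 : phi 1 = 1.
  by apply: (@mulgI _ (phi 1)); rewrite -phiM ?mulg1 //; exact: (Aw [::]).
have phiV w : phi (weval a b w)^-1 = (phi (weval a b w))^-1.
  apply: (@mulgI _ (phi (weval a b w))); rewrite mulgV -phiM ?mulgV //.
  by rewrite -weval_inv.
elim=> [|l w IHw] //=; rewrite -/(weval a b w) -IHw phiM //; last first.
  by have := Aw [:: l]; rewrite /= mulg1.
congr (_ * _); case: l => i s /=.
by have := phiV [:: (i, false)]; rewrite /= mulg1; case: i; case: s.
Qed.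

Section PresentedEvaluation.
Variable (G : groupType) (a b : G) (rels : set (word bool)).
Hypothesis relsG : forall r, rels r -> weval a b r = 1.

Lemma weval_pres_equiv v w :
  pres_equiv rels v w -> weval a b v = weval a b w.
Proof.
elim=> [_ _ [u' v' [i s]|u' v' r Rr]|//|u' v' _ -> //|u' v' w' _ -> _ -> //].
  rewrite !weval_cat /= mulg1; congr (_ * _).
  by case: s; case: i; rewrite /= ?(mulgV, mulVg) mul1g.
by rewrite !weval_cat (relsG Rr) mul1g.
Qed.

End PresentedEvaluation.

Lemma weval_pi (rels : set (word bool)) (w : word bool) :
  weval (\pi_(presented rels) letterA) (\pi_(presented rels) letterB) w =
  \pi_(presented rels) w.
Proof.
elim: w => [//|[i s] w IHw]; rewrite /= -/(weval _ _ w) IHw -(cat1s (i, s) w).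
transitivity (\pi_(presented rels) [:: (i, s)] * \pi_(presented rels) w).
  congr (_ * _); case: i; case: s => //; exact: pres_inv_pi.
exact: pres_mul_pi.
Qed.

(* The infinite presentation of F: [x_k^-1 x_n x_k = x_(n+1)] for [k < n]. *)
Definition thompson_seq (G : groupType) (x : nat -> G) :=
  forall k n, (k < n)%N -> x n * x k = x k * x n.+1.

Definition tseq (G : groupType) (a b : G) (n : nat) : G :=
  if n is m.+1 then b ^ ((a * b) ^+ m) else a * b.

(** Conjugation by [t] shifts the indices from 1 on, so it suffices to conjugate by [x 1]. If [a]
    commutes with [x n.+2], then [x n.+2 ^ x 1 = x n.+3]; the two relators give the cases n = 0 and
    n = 1. *)
Lemma tseqP (G : groupType) (a b : G) :
  (forall r, thompson_rels r -> weval a b r = 1) -> thompson_seq (tseq a b).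
Proof.
move=> relsG; set x := tseq a b; set t := a * b.
have xS n : x n.+2 = x n.+1 ^ t by rewrite -conjgM -expgSr.
have xSD m n : x (n + m).+1 = x n.+1 ^ (t ^+ m).
  elim: m => [|m IHm]; first by rewrite addn0 conjg1.
  by rewrite addnS xS IHm -conjgM -expgSr.
have x1 : x 1%N = b by rewrite /x /= conjg1.
have conj1 n : a * x n.+2 = x n.+2 * a -> x n.+2 ^ x 1%N = x n.+3.
  by move=> an; rewrite (xS n.+1) x1 conjgM [_ ^ a]conjgE -an mulKg.
have conj2 : x 2%N ^ x 1%N = x 3%N.
  apply: conj1; have /weval_comm := relsG _ (or_introl erefl).
  by rewrite !weval_cat !weval_inv !weval_cat /= !mulg1.
have conj3 : x 3%N ^ x 1%N = x 4%N.
  apply: conj1; have /weval_comm := relsG _ (or_intror erefl).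
  by rewrite !weval_cat !weval_inv !weval_cat /= !mulg1.
have shift n m k : x n.+1 ^ x 1%N = x m.+1 ->
    x (n + k).+1 ^ x k.+1 = x (m + k).+1.
  by move=> e; rewrite -[in x k.+1](add0n k) !xSD -conjJg e.
have conjS n : x n.+2 ^ x 1%N = x n.+3.
  elim/ltn_ind: n => -[|[|n]] IHn //.
  (* Shifting [conj2] writes each later generator through its two predecessors; conjugating this by
     [x 1] reduces to two smaller cases. *)
  have e k : x k.+3 = x k.+2 ^ x k.+1.
    by have := shift 1%N 2%N k conj2; rewrite add1n add2n.
  by rewrite [in LHS]e conjJg !IHn // -e.
move=> [|k] [|n] // kn; first by rewrite xS conjgC.
rewrite ltnS in kn; rewrite conjgC; congr (_ * _).
have [d ->] : exists d, n = (d.+1 + k)%N.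
  by exists (n - k).-1; rewrite prednK ?subn_gt0 // subnK // ltnW.
exact: (shift d.+1 d.+2 k (conjS d)).
Qed.

(** * Sorted positive words and their fractions *)

Definition xprod (G : groupType) (x : nat -> G) (s : seq nat) : G :=
  foldr (fun i y => x i * y) 1 s.

Section PositiveWords.
Variables (G : groupType) (x : nat -> G).
Hypothesis tx : thompson_seq x.

(** A letter moves right past a smaller one by [x i * x j = x j * x i.+1]. Lower bounds are carried
    along so that the induction can put the smaller letter back in front. *)
Lemma xprod_insert i s : sorted leq s ->
  exists s', [/\ sorted leq s', xprod x s' = x i * xprod x s &
    forall j, (j <= i)%N -> path leq j s -> path leq j s'].
Proof.
elim: s i => [|j s IHs] i ss; first by exists [:: i]; split=> //= j ->.
case: (leqP i j) => ij.
  by exists [:: i, j & s]; split; rewrite /= ?ij // => k ->.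
have [s' [s's s'E s'p]] := IHs i.+1 (path_sorted ss).
exists (j :: s'); split=> /=; first by apply: s'p; rewrite // ltnW // ltnW.
  by rewrite s'E mulgA -tx // mulgA.
by move=> k _ /andP[-> js]; apply: s'p; rewrite // ltnW // ltnW.
Qed.

Lemma xprod_sort s : exists2 s', sorted leq s' & xprod x s' = xprod x s.
Proof.
elim: s => [|i s [s' s's s'E]]; first by exists [::].
have [s'' [s''s s''E _]] := xprod_insert i s's.
by exists s'' => //; rewrite s''E s'E.
Qed.

(** An inverse letter travels right through a positive word: passing a different letter raises the
    larger of the two indices, and meeting its equal cancels it. *)
Lemma xprodV i s : exists s' t',
  (x i)^-1 * xprod x s = xprod x s' * (xprod x t')^-1.
Proof.
elim: s i => [|j s IHs] i /=; first by exists [::], [:: i]; rewrite /= !mulg1 mul1g.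
case: (ltngtP i j) => [ij|ji|->].
- have [s' [t' e]] := IHs i; exists (j.+1 :: s'), t'.
  by rewrite /= -mulgA -e; apply: (@mulgI _ (x i)); rewrite mulVKg !mulgA -tx // mulgK.
- have [s' [t' e]] := IHs i.+1; exists (j :: s'), t'.
  by rewrite /= -mulgA -e; apply: (@mulgI _ (x i)); rewrite mulVKg !mulgA tx // mulgK.
- by exists s, [::]; rewrite mulKg /= invg1 mulg1.
Qed.

Lemma xprod_frac a b : x 0 = a * b -> x 1%N = b ->
  forall w, exists s t, weval a b w = xprod x s * (xprod x t)^-1.
Proof.
move=> x0 x1; have aE : a = x 0 * (x 1%N)^-1 by rewrite x0 x1 mulgK.
have fracM i s t : exists s' t',
    x i * (xprod x s * (xprod x t)^-1) = xprod x s' * (xprod x t')^-1.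
  by exists (i :: s), t; rewrite mulgA.
have xprod_cat s t : xprod x (s ++ t) = xprod x s * xprod x t.
  by elim: s => [|j s IHs] /=; rewrite ?mul1g // IHs mulgA.
have fracV i s t : exists s' t',
    (x i)^-1 * (xprod x s * (xprod x t)^-1) = xprod x s' * (xprod x t')^-1.
  have [s' [t' e]] := xprodV i s.
  by exists s', (t ++ t'); rewrite mulgA e xprod_cat invgM mulgA.
elim=> [|[[] []] w [s [t e]]] /=.
- by exists [::], [::]; rewrite /= mul1g invg1.
- by rewrite -/(weval a b w) e -x1; exact: fracV.
- by rewrite -/(weval a b w) e -x1; exact: fracM.
- rewrite -/(weval a b w) e aE invgM invgK -mulgA.
  by have [s' [t' ->]] := fracV 0 s t; exact: fracM.
- rewrite -/(weval a b w) e aE -mulgA.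
  by have [s' [t' ->]] := fracV 1%N s t; exact: fracM.
Qed.

End PositiveWords.

(** Makes products comparable in two groups: one word in the generators spells both. *)
Lemma xprod_morph (G H : groupType) (x : nat -> G) (y : nat -> H)
    (v : nat -> word bool) (a b : G) (c d : H) :
  (forall n, x n = weval a b (v n)) -> (forall n, y n = weval c d (v n)) ->
  forall s, exists w, xprod x s = weval a b w /\ xprod y s = weval c d w.
Proof.
move=> xE yE; elim=> [|i s [w [e1 e2]]] /=; first by exists [::].
by exists (v i ++ w); rewrite !weval_cat -xE -yE -e1 -e2.
Qed.

(** * A criterion for a two-generated group to be F *)

Definition tword (n : nat) : word bool :=
  if n is m.+1 then
    let t := iter m (cat wordAB) [::] in word_inv t ++ letterB ++ t
  else wordAB.

Lemma tseqE (G : groupType) (a b : G) n : tseq a b n = weval a b (tword n).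
Proof.
case: n => [|n] /=; first by rewrite mulg1.
rewrite weval_cat weval_inv /= -/(weval a b _) /conjg.
suff -> : weval a b (iter n (cat wordAB) [::]) = (a * b) ^+ n by [].
by elim: n => [//|n IHn]; rewrite iterS weval_cat IHn expgS /= mulg1.
Qed.

(** A word trivial in [G] is, in F, a fraction of two sorted positive words. Their values in [G]
    agree, so the separation hypothesis makes them equal and the word is trivial in F. *)
Lemma thompson_inj (G : groupType) (a b : G) :
  (forall r, thompson_rels r -> weval a b r = 1) ->
  (forall s t, sorted leq s -> sorted leq t ->
     xprod (tseq a b) s = xprod (tseq a b) t -> s = t) ->
  isomorphic (generated [set a; b]) [set: thompsonF].
Proof.
move=> relsG sep; rewrite generated2E.
pose A : thompsonF := \pi_thompsonF letterA.
pose B : thompsonF := \pi_thompsonF letterB.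
have piE w : weval A B w = \pi_thompsonF w by exact: weval_pi.
have relsF r : thompson_rels r -> weval A B r = 1.
  move=> Rr; rewrite piE; apply/pres_eqP.
  by apply/rst_step; have := step_rel [::] [::] Rr; rewrite cats0.
have txF := tseqP relsF.
have inj w : weval a b w = 1 -> weval A B w = 1.
  have [s [t e]] := xprod_frac txF erefl (conjg1 B) w.
  have [s' ss' s'E] := xprod_sort txF s; have [t' st' t'E] := xprod_sort txF t.
  move: e; rewrite -s'E -t'E => e w1.
  suff s't' : s' = t' by rewrite e s't' mulgV.
  apply: sep => //.
  have [v1 [vF1 vG1]] := xprod_morph (tseqE A B) (tseqE a b) s'.
  have [v2 [vF2 vG2]] := xprod_morph (tseqE A B) (tseqE a b) t'.
  rewrite vG1 vG2.
  have /pres_eqP : \pi_thompsonF v1 = \pi_thompsonF (w ++ v2).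
    by rewrite -!piE weval_cat e vF1 vF2 mulgVK.
  by move/(weval_pres_equiv relsG); rewrite weval_cat w1 mul1g.
have wd v w : weval a b v = weval a b w <-> weval A B v = weval A B w.
  split=> [e|]; last by rewrite !piE => /pres_eqP /(weval_pres_equiv relsG).
  apply: (@mulgI _ (weval A B w)^-1); rewrite mulVg -weval_inv -weval_cat.
  by apply: inj; rewrite weval_cat weval_inv e mulVg.
have [phi phiE] : exists phi : G -> thompsonF,
    forall w, phi (weval a b w) = weval A B w.
  (* Off the values of words, [phi] takes the default value 1. *)
  exists (fun x => xget 1 [set y | exists w, weval a b w = x /\ weval A B w = y]).
  move=> w; case: xgetP => [y _ [v [/wd -> -> //]]|].
  by move=> /(_ (weval A B w)) []; exists w.
exists phi; split; last first.
  by move=> _ _ [v _ <-] [w _ <-]; rewrite -weval_cat !phiE weval_cat.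
split=> [x _ //|_ _ /set_mem[v _ <-] /set_mem[w _ <-]|].
  by rewrite !phiE => /wd.
elim/presented_ind=> w _; rewrite -piE.
by exists (weval a b w); [exists w | exact: phiE].
Qed.

(** * Homeomorphisms of the interval acting on the line *)

Section Action.
Variable R : realType.
Local Open Scope ring_scope.
Implicit Types (h k : homeoI R) (x y : R).

(** Extension by the identity outside [0, 1] turns the action into one on real numbers, free of
    subtypes. *)
Definition ext h x : R :=
  if insub x is Some z then set_val (h (z : `[0, 1 : R]%classic)) else x.

Lemma unitI_bound (z : unitI R) : 0 <= set_val z <= 1.
Proof. by have := set_valP z; rewrite /= in_itv. Qed.

Lemma unitI_ex x : 0 <= x <= 1 -> exists z : unitI R, x = set_val z.
Proof.
move=> x01; have xI : x \in (`[0, 1 : R]%classic : set R).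
  by apply/mem_set; rewrite /= in_itv.
by exists (SigSub xI); rewrite set_valE.
Qed.

Lemma set_val_unitI_inj : injective (set_val : unitI R -> R).
Proof. by move=> y z; rewrite set_valE => /val_inj. Qed.

Lemma ext_val h (z : unitI R) : ext h (set_val z) = set_val (h z).
Proof. by rewrite /ext {1}set_valE valK. Qed.

Lemma ext_out h x : ~~ (0 <= x <= 1) -> ext h x = x.
Proof.
move=> x01; rewrite /ext; case: insubP => [z _ zx|//].
by case/negP: x01; have := unitI_bound z; rewrite set_valE zx.
Qed.

Lemma ext_bound h x : 0 <= x <= 1 -> 0 <= ext h x <= 1.
Proof. by move=> /unitI_ex[z ->]; rewrite ext_val; exact: unitI_bound. Qed.

Lemma extM h k x : ext (h * k)%g x = ext h (ext k x).
Proof.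
have [/unitI_ex[z ->]|x01] := boolP (0 <= x <= 1); last by rewrite !ext_out.
by rewrite !ext_val.
Qed.

Lemma ext1 x : ext 1%g x = x.
Proof.
have [/unitI_ex[z ->]|x01] := boolP (0 <= x <= 1); last by rewrite !ext_out.
by rewrite ext_val.
Qed.

Lemma extK h x : ext h^-1%g (ext h x) = x.
Proof. by rewrite -extM mulVg ext1. Qed.

Lemma extVK h x : ext h (ext h^-1%g x) = x.
Proof. by rewrite -extM mulgV ext1. Qed.

Lemma ext_eq h k : ext h =1 ext k -> h = k.
Proof.
move=> e; apply: homeoI_eq; apply/funext => z; apply: set_val_unitI_inj.
by rewrite -!ext_val.
Qed.

Lemma ext_lt h x y : x < y -> ext h x < ext h y.
Proof.
move=> xy; have [/unitI_ex[u xu]|x01] := boolP (0 <= x <= 1);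
  have [/unitI_ex[v yv]|y01] := boolP (0 <= y <= 1).
- by rewrite xu yv !ext_val; apply: homeo_increasing; rewrite -xu -yv.
- have := unitI_bound (h u); rewrite -ext_val -xu (ext_out h y01).
  by have := unitI_bound u; rewrite -xu; move: y01; lra.
- have := unitI_bound (h v); rewrite -ext_val -yv (ext_out h x01).
  by have := unitI_bound v; rewrite -yv; move: x01; lra.
- by rewrite !ext_out.
Qed.

Lemma ext_lt_mono h : {mono ext h : x y / x < y}.
Proof. by apply: leW_mono; apply: le_mono => x y; exact: ext_lt. Qed.

Lemma ext_le_mono h : {mono ext h : x y / x <= y}.
Proof. by apply: le_mono => x y; exact: ext_lt. Qed.

Lemma ext_fix h x : x <= 0 \/ 1 <= x -> ext h x = x.
Proof.
have bnd k y : 0 <= y <= 1 -> 0 <= ext k y <= 1 by exact: ext_bound.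
have b0 k : 0 <= ext k 0 by have /andP[] := bnd k 0 ltac:(lra).
have b1 k : ext k 1 <= 1 by have /andP[] := bnd k 1 ltac:(lra).
have fix0 : ext h 0 = 0.
  by apply: le_anti; rewrite b0 -[leRHS](extVK h) ext_le_mono b0.
have fix1 : ext h 1 = 1.
  by apply: le_anti; rewrite b1 -[leLHS](extVK h) ext_le_mono b1.
have [x01|x01 _] := boolP (0 <= x <= 1); last exact: ext_out.
by case=> x0; [have -> : x = 0 by lra | have -> : x = 1 by lra].
Qed.

Lemma ext_natexp2 h x : ext (h ^+ 2)%g x = ext h (ext h x).
Proof. by rewrite expg2 extM. Qed.

Lemma supp_ext h : supp h = [set x | ext h x <> x].
Proof.
apply/seteqP; split=> [_ [z /= hz <-]|x /= hx].
  by rewrite ext_val => /set_val_unitI_inj.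
have [/unitI_ex[z xz]|x01] := boolP (0 <= x <= 1); last by rewrite ext_out in hx.
by exists z => // hz; apply: hx; rewrite xz ext_val hz.
Qed.

(** The preimage of an open interval is the open interval between the values of [G] at its ends. *)
Lemma incr_continuous (F G : R -> R) :
  {mono F : x y / x < y} -> cancel G F -> continuous F.
Proof.
move=> Fm GK x; apply/cvgrPdist_lt => e e0; near=> t.
have /andP[lo hi] : G (F x - e) < t < G (F x + e).
  suff : t \in `]G (F x - e), G (F x + e)[ by rewrite in_itv.
  by near: t; apply: near_in_itvoo; rewrite in_itv /= -(Fm _ x) -(Fm x) !GK; lra.
by move: lo hi; rewrite -(Fm _ t) -(Fm t) !GK ltr_norml; lra.
Unshelve. all: by end_near. Qed.

(** Builds group elements from explicit formulas: the slope bound makes [F] Lipschitz, hence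
    continuous; the intermediate value theorem makes it onto; its inverse is continuous by
    monotonicity. *)
Lemma homeo_exists (F : R -> R) (K : R) :
  (forall x y, x < y -> F x < F y <= F x + K * (y - x)) ->
  (forall x, x <= 0 -> F x = x) -> (forall x, 1 <= x -> F x = x) ->
  exists h : homeoI R, ext h =1 F.
Proof.
move=> FK F0 F1.
have Flt : {homo F : x y / x < y} by move=> x y /FK/andP[].
have Fle : {mono F : x y / x <= y} := le_mono Flt.
have Fm : {mono F : x y / x < y} := leW_mono Fle.
have Fc : continuous F.
  have K0 : 0 < K by have := FK 0 1 ltr01; rewrite F0 // F1 //; lra.
  move=> x; apply/cvgrPdist_lt => e e0; near=> t.
  have xt : `|x - t| < e / K by near: t; apply: cvgr_dist_lt => //; rewrite divr_gt0.
  move: xt; rewrite ltr_pdivlMr // => xt; apply: le_lt_trans xt.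
  have [xt|tx|->] := ltgtP x t; last by rewrite !subrr normr0 mul0r.
    by have /andP[? ?] := FK _ _ xt; rewrite !ler0_norm; lra.
  by have /andP[? ?] := FK _ _ tx; rewrite !ger0_norm; lra.
have surj y : exists x, F x = y.
  have [y0|y0] := leP y 0; first by exists y; exact: F0.
  have [y1|y1] := leP 1 y; first by exists y; exact: F1.
  have [||x _ <-] := @IVT R F 0 1 y ler01; last by exists x.
    exact: continuous_subspaceT.
  by rewrite F0 // F1 // min_l ?ler01 // max_r ?ler01 // ltW //= ltW.
have [G GK] := choice surj.
have FG : cancel F G by move=> x; apply: (inc_inj Fle); rewrite GK.
have Gm : {mono G : x y / x < y} by move=> x y; rewrite -Fm !GK.
have Gc : continuous G := incr_continuous Gm FG.
have FI x : 0 <= x <= 1 -> 0 <= F x <= 1.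
  by move=> /andP[x0 x1]; rewrite -(F0 0) // -(F1 1) // !Fle x0.
have GI x : 0 <= x <= 1 -> 0 <= G x <= 1.
  by move=> x01; rewrite -[0 <= _]Fle -[_ <= 1]Fle GK F0 // F1.
(* The subspace topology is initial for the inclusion, so continuity of a restriction is tested in
   the line. *)
have ext_to (H : R -> R) : (forall x, 0 <= x <= 1 -> 0 <= H x <= 1) ->
    continuous H -> exists2 H' : unitI R -> unitI R,
      forall z : unitI R, set_val (H' z) = H (set_val z) & continuous H'.
  move=> HI Hc; have ex (z : unitI R) : exists z' : unitI R, set_val z' = H (set_val z).
    by have [z' ->] := unitI_ex (HI _ (unitI_bound z)); exists z'.
  have [H' H'E] := choice ex; exists H' => //.
  apply: continuous_comp_initial.
  have -> : set_val \o H' = H \o set_val by apply/funext.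
  move=> z; apply: continuous_comp; last exact: Hc.
  exact: initial_continuous.
have [F' F'E F'c] := ext_to F FI Fc; have [G' G'E G'c] := ext_to G GI Gc.
have F'K : cancel F' G'.
  by move=> z; apply: set_val_unitI_inj; rewrite G'E F'E FG.
have G'K : cancel G' F'.
  by move=> z; apply: set_val_unitI_inj; rewrite F'E G'E GK.
have F'lt (x y : unitI R) : set_val x < set_val y -> set_val (F' x) < set_val (F' y).
  by rewrite !F'E Fm.
exists (HomeoI F'K G'K F'c G'c F'lt) => x.
have [/unitI_ex[z ->]|x01] := boolP (0 <= x <= 1); first by rewrite ext_val F'E.
rewrite ext_out //; case: (leP x 0) => x0; first by rewrite F0.
by rewrite F1 //; move: x01; lra.
Unshelve. all: by end_near. Qed.

End Action.

Arguments ext {R} h%_g x%_R.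

(** * Two-chains with fast overlap generate F *)

Section Bumps.
Variable R : realType.
Implicit Types (h k : homeoI R) (x y l u : R).

Definition down_bump h l u :=
  (forall x, (l < x < u)%R -> (ext h x < x)%R) /\
  (forall x, (x <= l \/ u <= x)%R -> ext h x = x).

Lemma down_le h l u x : down_bump h l u -> (ext h x <= x)%R.
Proof.
move=> [hd hf]; have [lx|xl] := ltP l x; last by rewrite hf //; left.
have [xu|ux] := ltP x u; last by rewrite hf //; right.
by apply: ltW; apply: hd; rewrite lx.
Qed.

Lemma down_supp h l u : down_bump h l u -> supp h = `]l, u[%classic.
Proof.
move=> [hd hf]; rewrite supp_ext; apply/seteqP.
split=> x /=; rewrite in_itv /=; last by move=> /hd + e; rewrite e ltxx.
move=> hx; have [lx|xl] /= := ltP l x; last by case: hx; apply: hf; left.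
by rewrite ltNge; apply/negP => ux; apply: hx; apply: hf; right.
Qed.

Lemma down_invl h l u x : down_bump h l u -> (l < x < u)%R ->
  (x < ext h^-1 x < u)%R.
Proof.
move=> [hd hf] /[dup] xlu /andP[lx xu]; apply/andP; split.
  by rewrite -(ext_lt_mono h) extVK hd.
by rewrite -(ext_lt_mono h) extVK (hf u) //; right.
Qed.

Lemma up_down_inv h l u : (forall x, (l < x < u)%R -> (x < ext h x)%R) ->
  (forall x, (x <= l \/ u <= x)%R -> ext h x = x) -> (l < u)%R ->
  down_bump h^-1 l u.
Proof.
move=> hu hf lu; have fixV x : (x <= l \/ u <= x)%R -> ext h^-1 x = x.
  by move=> xlu; rewrite -{1}(hf x xlu) extK.
split=> // x /andP[lx xu]; rewrite -(ext_lt_mono h) extVK; apply: hu.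
by rewrite lx.
Qed.

Lemma down_sqr h l u : down_bump h l u -> down_bump (h ^+ 2) l u.
Proof.
move=> hd; split=> x xlu; rewrite ext_natexp2; last by rewrite !hd.2.
by apply: le_lt_trans (down_le _ hd) _; exact: hd.1.
Qed.

(** Here [h ^ k] is [k^-1 * h * k] and the product is composition, so [k^-1] moves the support. *)
Lemma down_conj h k l u : down_bump h l u ->
  down_bump (h ^ k) (ext k^-1 l) (ext k^-1 u).
Proof.
move=> [hd hf]; split=> x xlu; rewrite !extM.
  rewrite -(ext_lt_mono k) extVK; apply: hd.
  by move: xlu; rewrite -(ext_lt_mono k) -[(x < _)%R](ext_lt_mono k) !extVK.
rewrite hf ?extK //.
by case: xlu; rewrite -(ext_le_mono k) extVK; [left|right].
Qed.

(** The point [l'] separates the supports, and neither map carries a point across it. *)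
Lemma down_commute h k l u l' u' : down_bump h l u -> down_bump k l' u' ->
  (u <= l')%R -> h * k = k * h.
Proof.
move=> [hd hf] [kd kf] ul; apply: ext_eq => x; rewrite !extM.
have [xl|lx] := leP x l'.
  rewrite kf; last by left.
  rewrite kf //; left; apply: le_trans xl.
  exact: (down_le (l := l) (u := u)).
rewrite (hf x); last by right; apply: ltW; exact: le_lt_trans lx.
rewrite hf //; right; apply: le_trans ul _.
have <- : ext k l' = l' by apply: kf; left.
by rewrite ext_le_mono ltW.
Qed.

(** If they commuted, [h^-1] would send [l'], fixed by [k], to a fixed point of [k]; but this image
    lies strictly between [l'] and [u], where [k] moves every point. *)
Lemma down_ncommute h k l u l' u' : down_bump h l u -> down_bump k l' u' ->
  (l < l' < u)%R -> (u <= u')%R -> h * k <> k * h.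
Proof.
move=> hD kD /(down_invl hD)/andP[l'y yu] uu' e.
have : ext k (ext h^-1 l') = ext h^-1 l'.
  rewrite -extM -[k * _](mulKg h) [h * (k * _)]mulgA e mulgK extM kD.2 //.
  by left.
apply/eqP; rewrite lt_eqF // kD.1 // l'y /=.
exact: lt_le_trans uu'.
Qed.

End Bumps.

Section TwoChain.
Variables (R : realType) (a b : homeoI R) (r s : R).
Hypotheses (r0 : (0 < r)%R) (rs : (r < s)%R) (s1 : (s < 1)%R).
Hypotheses (ad : down_bump a 0%R s) (bd : down_bump b r 1%R).
Hypothesis abs : (ext a (ext b s) <= r)%R.

Let t := a * b.

Let td : down_bump t 0%R 1%R.
Proof.
split=> x; rewrite extM.
  move=> /andP[x0 x1]; have [rx|xr] := ltP r x.
    by apply: le_lt_trans (down_le _ ad) _; apply: bd.1; rewrite rx.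
  rewrite (bd.2 x); last by left.
  by apply: ad.1; rewrite x0; exact: le_lt_trans rs.
move=> x01; have bx : ext b x = x.
  apply: bd.2; case: x01 => [x0|]; last by right.
  by left; apply: le_trans x0 (ltW r0).
rewrite bx; apply: ad.2; case: x01 => [|x1]; first by left.
by right; apply: le_trans x1; exact: ltW.
Qed.

(** The left end of the support of [tseq a b n]. *)
Definition chain_pt n : R := if n is m.+1 then ext (t ^+ m)^-1 r else 0%R.

Let ptS01 n : (0 < chain_pt n.+1 < 1)%R.
Proof.
rewrite /=; apply/andP; split.
  by rewrite -[ltLHS](ext_fix (t ^+ n)^-1 (or_introl (lexx 0%R))) ext_lt_mono.
rewrite -[ltRHS](ext_fix (t ^+ n)^-1 (or_intror (lexx 1%R))) ext_lt_mono.
exact: lt_trans rs s1.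
Qed.

Let ptS n : (chain_pt n < chain_pt n.+1)%R.
Proof.
case: n => [|n]; first by have /andP[] := ptS01 0.
have /(down_invl td)/andP[+ _] := ptS01 n.
by rewrite /= expgSr [(_ ^+ n * _)^-1]invgM extM.
Qed.

Let pt_lt : {homo chain_pt : m n / (m < n)%N >-> (m < n)%R}.
Proof. by apply: homo_ltn => [x y z|]; [exact: lt_trans | exact: ptS]. Qed.

Let pt1 n : (chain_pt n < 1)%R.
Proof. by case: n => [|n]; [exact: ltr01 | have /andP[] := ptS01 n]. Qed.

Let tseq_down n : down_bump (tseq a b n) (chain_pt n) 1%R.
Proof.
case: n => [|n] //=.
rewrite -[X in down_bump _ _ X](ext_fix (t ^+ n)^-1 (or_intror (lexx 1%R))).
exact: down_conj.
Qed.

Let xprod_le s' x : (ext (xprod (tseq a b) s') x <= x)%R.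
Proof.
elim: s' => [|i s' IHs] /=; first by rewrite ext1.
by rewrite extM; apply: le_trans IHs; exact: down_le (tseq_down i).
Qed.

Let xprod_fix s' n x : path leq n s' -> (x <= chain_pt n)%R ->
  ext (xprod (tseq a b) s') x = x.
Proof.
elim: s' n => [|i s' IHs] n /=; first by rewrite ext1.
move=> /andP[ni is_] xn.
have xi : (x <= chain_pt i)%R.
  by apply: le_trans xn _; move: ni; rewrite leq_eqVlt => /predU1P[->//|/pt_lt/ltW].
by rewrite extM (IHs i) // (tseq_down i).2 //; left.
Qed.

Let xprod_lt i s' x : (chain_pt i < x < 1)%R ->
  (ext (xprod (tseq a b) (i :: s')) x < x)%R.
Proof.
move=> ix; rewrite /= extM; apply: le_lt_trans ((tseq_down i).1 x ix).
by rewrite ext_le_mono xprod_le.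
Qed.

(** A sorted word starts with its least letter. If the first letters are i < j, the word starting
    with i moves [chain_pt j] and the other fixes it; equal first letters cancel. *)
Lemma chain_sep s' t' : sorted leq s' -> sorted leq t' ->
  xprod (tseq a b) s' = xprod (tseq a b) t' -> s' = t'.
Proof.
have lt_false i j u v : (i < j)%N -> path leq j v ->
    xprod (tseq a b) (i :: u) <> xprod (tseq a b) (j :: v).
  move=> ij jv e; have := @xprod_lt i u (chain_pt j).
  rewrite pt_lt // pt1 e (@xprod_fix (j :: v) j) //= ?leqnn // => /(_ isT).
  by rewrite ltxx.
have nil_false i u : xprod (tseq a b) (i :: u) <> 1.
  move=> e; have := @xprod_lt i u (chain_pt i.+1).
  by rewrite ptS pt1 e ext1 => /(_ isT); rewrite ltxx.
elim: s' t' => [|i s' IHs] [|j t'] //= is_ jt e.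
- by case: (nil_false j t').
- by case: (nil_false i s').
case: (ltngtP i j) => ij.
- by case: (lt_false _ _ s' _ ij jt).
- by case: (lt_false _ _ t' _ ij is_).
- rewrite ij in e is_ *; congr (_ :: _).
  by apply: IHs (path_sorted is_) (path_sorted jt) _; exact: mulgI e.
Qed.

Lemma two_chain_thompson : isomorphic (generated [set a; b]) [set: thompsonF].
Proof.
apply: thompson_inj; last exact: chain_sep.
(* The support of [b ^ (t ^+ n)] starts at the preimage of [r] under [t ^+ n], so it misses that of
   [a] once [t ^+ n] brings [s] down to [r]. This holds for n = 1 by [abs], and for n = 2 since [t]
   moves points down. *)
have comm n : (ext (t ^+ n) s <= r)%R -> a * b ^ (t ^+ n) = b ^ (t ^+ n) * a.
  move=> sr; apply: (down_commute ad (down_conj (t ^+ n) bd)).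
  by rewrite -(ext_le_mono (t ^+ n)) extVK.
move=> w [] ->; apply/weval_comm; rewrite !weval_cat !weval_inv !weval_cat /= !mulg1.
  by have := comm 1%N; rewrite expg1 extM; exact.
have := comm 2%N; rewrite ext_natexp2 expg2; apply.
by apply: le_trans (down_le _ td) _; rewrite extM.
Qed.

End TwoChain.

(** * A family of square roots *)

Section Maps.
Variable R : realType.
Local Open Scope ring_scope.
Implicit Types (e x y : R).

Definition gmap x :=
  if x <= 1/3 then x else if x <= 2/3 then 1/6 + x/2
  else if x <= 1 then 3/2 * x - 1/2 else x.

Definition lmap x :=
  if x <= 0 then x else if x <= 1/3 then 5/4 * x
  else if x <= 2/3 then 1/6 + 3/4 * x else x.

(** Supported on the image of [1/3, 4/9] under [lmap] and zero at 5/12, so that the perturbation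
    leaves the image of 1/3 unchanged. *)
Definition tent x :=
  if x <= 5/12 then 0 else if x <= 11/24 then x - 5/12
  else if x <= 1/2 then 1/2 - x else 0.

(* The parameter moves the image of 5/12 to [23/48 + e/48] and changes nothing
   on [[4/9, 2/3]], where the orbit of 1/3 is studied. *)
Definition kmap e x := lmap x + e * tent (lmap x).

Lemma gmap_slope x y : x < y -> gmap x < gmap y <= gmap x + 5/2 * (y - x).
Proof.
move=> xy; rewrite /gmap.
case: (leP x (1/3)); case: (leP x (2/3)); case: (leP x 1);
case: (leP y (1/3)); case: (leP y (2/3)); case: (leP y 1); lra.
Qed.

Lemma lmap_slope x y : x < y -> lmap x < lmap y <= lmap x + 5/4 * (y - x).
Proof.
move=> xy; rewrite /lmap.
case: (leP x 0); case: (leP x (1/3)); case: (leP x (2/3));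
case: (leP y 0); case: (leP y (1/3)); case: (leP y (2/3)); lra.
Qed.

Lemma tent_slope x y : x < y -> - (y - x) <= tent y - tent x <= y - x.
Proof.
move=> xy; rewrite /tent.
case: (leP x (5/12)); case: (leP x (11/24)); case: (leP x (1/2));
case: (leP y (5/12)); case: (leP y (11/24)); case: (leP y (1/2)); lra.
Qed.

(** Adding [e] times the tent to the identity gives slopes between 1 - e > 0 and 2, while those of
    [lmap] are at most 5/4. *)
Lemma kmap_slope e x y : 0 <= e < 1 -> x < y ->
  kmap e x < kmap e y <= kmap e x + 5/2 * (y - x).
Proof.
move=> e01 xy; have := lmap_slope xy; rewrite /kmap => /andP[lxy lyx].
by have := tent_slope lxy; nra.
Qed.

Lemma tent_ge0 x : 0 <= tent x.
Proof.
by rewrite /tent; case: (leP x (5/12)); case: (leP x (11/24)); case: (leP x (1/2)); lra.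
Qed.

Lemma kmap_fix e x : x <= 0 \/ 2/3 <= x -> kmap e x = x.
Proof.
move=> x01; have lx : lmap x = x.
  rewrite /lmap; case: (leP x 0); case: (leP x (1/3)); case: (leP x (2/3)); lra.
rewrite /kmap lx /tent.
by case: (leP x (5/12)); case: (leP x (11/24)); case: (leP x (1/2)); lra.
Qed.

Lemma kmap_up e x : 0 <= e -> 0 < x < 2/3 -> x < kmap e x.
Proof.
move=> e0 x01; have := mulr_ge0 e0 (tent_ge0 (lmap x)); rewrite /kmap.
suff : x < lmap x by lra.
by rewrite /lmap; case: (leP x 0); case: (leP x (1/3)); case: (leP x (2/3)); lra.
Qed.

Lemma kmapE e x : 4/9 <= x <= 2/3 -> kmap e x = 1/6 + 3/4 * x.
Proof.
move=> xl; have lx : lmap x = 1/6 + 3/4 * x.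
  rewrite /lmap; case: (leP x 0); case: (leP x (1/3)); case: (leP x (2/3)); lra.
rewrite /kmap lx (_ : tent _ = 0) ?mulr0 ?addr0 // /tent.
have : 1/2 <= 1/6 + 3/4 * x by lra.
move: (1/6 + _) => z.
by case: (leP z (5/12)); case: (leP z (11/24)); case: (leP z (1/2)); lra.
Qed.

Lemma kmap_13 e : kmap e (1/3) = 5/12.
Proof.
have lx : lmap (1/3) = 5/12 :> R.
  by rewrite /lmap; case: (leP (1/3 : R) 0); case: (leP (1/3 : R) (1/3)); lra.
by rewrite /kmap lx /tent lexx mulr0 addr0.
Qed.

Lemma kmap_512 e : kmap e (5/12) = 23/48 + e/48.
Proof.
have lx : lmap (5/12) = 23/48 :> R.
  rewrite /lmap; case: (leP (5/12 : R) 0); case: (leP (5/12 : R) (1/3));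
  case: (leP (5/12 : R) (2/3)); lra.
rewrite /kmap lx /tent; case: (leP (23/48 : R) (5/12)); first lra.
case: (leP (23/48 : R) (11/24)); first lra.
case: (leP (23/48 : R) (1/2)); lra.
Qed.

Lemma gmap_fix x : x <= 1/3 \/ 1 <= x -> gmap x = x.
Proof.
rewrite /gmap.
case: (leP x (1/3)); case: (leP x (2/3)); case: (leP x 1); lra.
Qed.

Lemma gmap_down x : 1/3 < x < 1 -> gmap x < x.
Proof.
rewrite /gmap.
case: (leP x (1/3)); case: (leP x (2/3)); case: (leP x 1); lra.
Qed.

Lemma gmapE x : 1/3 <= x <= 2/3 -> gmap x = 1/6 + x/2.
Proof.
rewrite /gmap; case: (leP x (1/3)); case: (leP x (2/3)); lra.
Qed.

End Maps.

(** * Relators of generating pairs of isomorphic groups *)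

Lemma isomorphic_refl (G : groupType) (A : set G) : isomorphic A A.
Proof.
by exists id; split=> //; split=> // x Ax; exists x.
Qed.

(** The preimages of [c] and [d] are words in [a] and [b]. Thus the relators of (c, d) are
    determined by a pair of words, and such pairs are countable. *)
Lemma isomorphic_relators (G H : groupType) (a b : G) (c d : H) :
  isomorphic (generated [set a; b]) (generated [set c; d]) ->
  exists W : word bool * word bool, forall w,
    weval (weval a b W.1) (weval a b W.2) w = 1 <-> weval c d w = 1.
Proof.
rewrite !generated2E => -[phi [[phiT phiI phiS] phiM]].
have [_ [u _ <-] uc] : (phi @` range (weval a b)) c.
  by apply: phiS; exists letterA; rewrite //= mulg1.
have [_ [v _ <-] vd] : (phi @` range (weval a b)) d.
  by apply: phiS; exists letterB; rewrite //= mulg1.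
pose sub (w : word bool) : word bool := flatten
  [seq (if l.2 then word_inv (if l.1 then v else u) else if l.1 then v else u)
  | l <- w].
have subE w : weval a b (sub w) = weval (weval a b u) (weval a b v) w.
  elim: w => [//|[i s] w IHw]; rewrite /sub /= weval_cat -/(sub w) IHw.
  by congr (_ * _); case: s; rewrite ?weval_inv; case: i.
exists (u, v) => w /=; rewrite -uc -vd.
have wA : range (weval (weval a b u) (weval a b v)) `<=` range (weval a b).
  by move=> _ [w' _ <-]; exists (sub w').
rewrite -(weval_morph wA phiM).
have phi1 : phi 1 = 1.
  apply: (@mulgI _ (phi 1)); rewrite -phiM ?mulg1 //; by exists [::].
rewrite -[X in _ <-> _ = X]phi1; split=> [->//|]; apply: phiI; apply/mem_set.
  by rewrite -subE; exists (sub w).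
by exists [::].
Qed.

(** * The square roots in the family and their separation by relators *)

Section Family.
Variables (R : realType) (g : homeoI R) (k : R -> homeoI R).
Hypothesis gE : ext g =1 @gmap R.
Hypothesis kE : forall e, (0 <= e < 1)%R -> ext (k e) =1 kmap e.

Lemma f_down e : (0 <= e < 1)%R -> down_bump (k e)^-1 0%R (2/3)%R.
Proof.
move=> e01; apply: up_down_inv => [x x01|x x01|]; last by lra.
  by rewrite kE // kmap_up //; case/andP: e01.
by rewrite kE // kmap_fix.
Qed.

Lemma g_down : down_bump g (1/3)%R 1%R.
Proof. by split=> x x01; rewrite gE; [exact: gmap_down | exact: gmap_fix]. Qed.

Lemma g_sqr_23 : ext (g ^+ 2) (2/3)%R = (5/12)%R.
Proof. by rewrite ext_natexp2 !gE (gmapE (x := 2/3)) ?gmapE; lra. Qed.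

Lemma family_square_root e : (0 <= e < 1)%R ->
  square_root_of_F (generated [set (k e)^-1; g]).
Proof.
move=> e01; exists (k e)^-1, g; split=> //.
  apply: (@two_chain_thompson R _ _ (1/3) (2/3)); try lra.
  - exact/down_sqr/f_down.
  - exact/down_sqr/g_down.
  (* Applying [k e] twice turns the overlap condition into 5/12 <= 23/48 + e/48. *)
  - rewrite g_sqr_23 ext_natexp2 -(ext_le_mono (k e)) extVK.
    rewrite -(ext_le_mono (k e)) extVK !kE // kmap_13 kmap_512; lra.
rewrite /two_chain (down_supp (f_down e01)) (down_supp g_down).
split.
- by exists 0%R, (2/3)%R; split=> //; lra.
- by exists (1/3)%R, 1%R; split=> //; lra.
- by exists (1/2)%R; split; rewrite /= in_itv /=; lra.
- move=> x y [/= + +] [/= + +] z; rewrite /= !in_itv /= => *.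
  split; lra.
- split; split=> [x []//|].
    by move=> /(_ (1/6)%R); rewrite /= !in_itv /=; case; lra.
  by move=> /(_ (5/6)%R); rewrite /= !in_itv /=; case; lra.
Qed.

(* Points of the orbit of 1/3 that are reached by a word that works for all
   parameters at once. *)
Definition common_pt (v : R) := exists w, forall e, (0 <= e < 1)%R ->
  ext (weval (k e)^-1 g w) (1/3)%R = v.

Lemma common_pt_13 : common_pt (1/3).
Proof. by exists [::] => e _; rewrite ext1. Qed.

Lemma common_pt_gmap v : common_pt v -> common_pt (gmap v).
Proof.
move=> [w wE]; exists (letterB ++ w) => e e01.
by rewrite weval_cat extM wE //= mulg1 gE.
Qed.

Lemma common_pt_gmapV v : common_pt (gmap v) -> common_pt v.
Proof.
move=> [w wE]; exists (word_inv letterB ++ w) => e e01.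
by rewrite weval_cat extM wE //= mulg1 -gE extK.
Qed.

Lemma common_pt_kmap v v' : (forall e, (0 <= e < 1)%R -> kmap e v = v') ->
  common_pt v -> common_pt v'.
Proof.
move=> vv' [w wE]; exists (word_inv letterA ++ w) => e e01.
by rewrite weval_cat extM wE //= mulg1 invgK kE ?vv'.
Qed.

(** Both [gmap] at 1/2 and every [kmap e] at 1/3 give 5/12. *)
Lemma common_pt_12 : common_pt (1/2).
Proof.
apply: common_pt_gmapV; rewrite gmapE; last by lra.
apply: common_pt_kmap common_pt_13 => e _; rewrite kmap_13; lra.
Qed.

(* [g] and [k e] map [1/3, 2/3] and [4/9, 2/3] onto the two halves of
   [1/3, 2/3], contracting by 1/2 and 3/4. *)
Lemma common_pt_near n (y : R) : (1/3 <= y <= 2/3)%R -> exists v,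
  [/\ common_pt v, (1/3 <= v <= y)%R & (y <= v + (3/4) ^+ n)%R].
Proof.
elim: n y => [|n IHn] y y01.
  by exists (1/3)%R; split; [exact: common_pt_13 | lra | rewrite expr0; lra].
rewrite exprS; have [y2|y2] := leP y (1/2)%R.
  have [|v [cv vy yv]] := IHn (2 * (y - 1/6))%R; first lra.
  have vE : gmap v = (1/6 + v/2)%R by rewrite gmapE; lra.
  exists (1/6 + v/2)%R; split; [rewrite -vE; exact: common_pt_gmap|lra|].
  have : (0 <= (3/4 : R) ^+ n)%R by rewrite exprn_ge0; lra.
  lra.
have [|v [cv vy yv]] := IHn (4/3 * (y - 1/6))%R; first lra.
have [v49|v49] := leP (4/9)%R v.
  exists (1/6 + 3/4 * v)%R; split; [|lra|lra].
  by apply: common_pt_kmap cv => e _; rewrite kmapE; lra.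
(* Left of 4/9 the image of [v] may depend on [e]. But then 1/6 + 3/4 v < 1/2 < y, so 1/2 is an even
   closer approximation from below. *)
by exists (1/2)%R; split; [exact: common_pt_12|lra|lra].
Qed.

(** An approximation of the midpoint [z] from below with error less than z - x stays between [x] and
    [y]. *)
Lemma common_pt_dense (x y : R) : (1/3 <= x)%R -> (x < y)%R -> (y <= 2/3)%R ->
  exists2 v, common_pt v & (x <= v < y)%R.
Proof.
move=> x13 xy y23; pose z := ((x + y) / 2)%R.
have [n nz] : exists n, ((3/4) ^+ n < z - x :> R)%R.
  have /cvgrPdist_lt/(_ (z - x)%R) : (fun n => (3/4 : R) ^+ n)%R @ \oo --> (0 : R)%R.
    by apply: cvg_expr; rewrite ger0_norm; lra.
  case; first by rewrite /z; lra.
  move=> n _ /(_ n (leqnn n)) /=; rewrite sub0r normrN ger0_norm; first by exists n.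
  by rewrite exprn_ge0; lra.
have [|v [cv vz zv]] := @common_pt_near n z; first by rewrite /z; lra.
by exists v => //; move: nz zv vz; rewrite /z; lra.
Qed.

(** At parameter d, [u1] has support (0, 23/48 + d/48) and [u2] has support (v, 1) with [v]
    independent of d. As [v] lies between the right ends for [e] and [e'], the commutator of [u1]
    and [u2] is a relator only for [e]. *)
Lemma relators_separate e e' : (0 <= e)%R -> (e < e')%R -> (e' < 1)%R ->
  exists w, weval (k e)^-1 g w = 1 /\ weval (k e')^-1 g w <> 1.
Proof.
move=> e0 ee' e1.
have [|||v [w wv] evx] := @common_pt_dense (23/48 + e/48)%R (23/48 + e'/48)%R; try lra.
(* The inverse of the value of [kw] is [k d * g ^+ 2], which sends 2/3 through 5/12 to 23/48 +
   d/48. *)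
pose kw : word bool := word_inv (letterB ++ letterB) ++ letterA.
pose u1 : word bool := word_inv kw ++ letterA ++ kw.
pose u2 : word bool := w ++ letterB ++ word_inv w.
have u1E d : weval (k d)^-1 g u1 = (k d)^-1 ^ (g ^- 2 * (k d)^-1).
  by rewrite /u1 /kw !weval_cat !weval_inv !weval_cat !weval_inv !weval_cat /= !mulg1.
have u2E d : weval (k d)^-1 g u2 = g ^ (weval (k d)^-1 g w)^-1.
  by rewrite !weval_cat weval_inv /= mulg1 conjgE invgK.
have u1d d : (0 <= d < 1)%R ->
    down_bump (weval (k d)^-1 g u1) 0%R (23/48 + d/48)%R.
  move=> d01; rewrite u1E.
  have := down_conj (g ^- 2 * (k d)^-1) (f_down d01).
  rewrite [(_ * (k d)^-1)^-1]invgM !invgK ![ext (k d * _) _]extM.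
  rewrite g_sqr_23 (down_sqr g_down).2; last by left; lra.
  by rewrite !kE // kmap_512 kmap_fix //; left.
have u2d d : (0 <= d < 1)%R -> down_bump (weval (k d)^-1 g u2) v 1%R.
  move=> d01; rewrite u2E.
  have := down_conj (weval (k d)^-1 g w)^-1 g_down.
  rewrite invgK wv //; rewrite ext_fix //; right; exact: lexx.
exists (word_comm u1 u2); split.
  apply/weval_comm; apply: (down_commute (u1d e _) (u2d e _)); lra.
move=> /weval_comm; apply: (down_ncommute (u1d e' _) (u2d e' _)); lra.
Qed.

End Family.

(** * Uncountability *)

(** With a base point [x0] fixed, each [x] in [D] gets a pair of words in the generators at [x0]
    having the relators of [x]. The pair determines the relators, hence [x]. *)
Lemma countable_relators (T : Type) (G : groupType) (a b : T -> G) (D : set T) :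
  (forall x y, D x -> D y ->
     isomorphic (generated [set a x; b x]) (generated [set a y; b y])) ->
  (forall x y, D x -> D y ->
     (forall w, weval (a x) (b x) w = 1 <-> weval (a y) (b y) w = 1) -> x = y) ->
  countable D.
Proof.
move=> iso sep; have [->|/set0P[x0 Dx0]] := eqVneq D set0; first exact: countable0.
have /choice[W WP] x : exists V : word bool * word bool, D x -> forall w,
    weval (weval (a x0) (b x0) V.1) (weval (a x0) (b x0) V.2) w = 1 <->
    weval (a x) (b x) w = 1.
  have [Dx|nDx] := pselect (D x); last by exists ([::], [::]).
  by have [V VP] := isomorphic_relators (iso _ _ Dx0 Dx); exists V.
apply/countable_injP; exists (fun x => pickle (W x)) => x y /set_mem Dx /set_mem Dy.
move=> /(pcan_inj pickleK) Wxy; apply: sep => // w.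
by rewrite -(WP x) // -(WP y) // Wxy.
Qed.

Theorem theorem1p9 (R : realType) : ~ countable (square_root_classes R).
Proof.
have [g gE] : exists g : homeoI R, ext g =1 @gmap R.
  apply: (homeo_exists (K := 5/2)) => [x y|x x0|x x1]; first exact: gmap_slope.
    by apply: gmap_fix; left; lra.
  by apply: gmap_fix; right; lra.
have /choice[k kE] e : exists h : homeoI R, (0 <= e < 1)%R -> ext h =1 kmap e.
  (* Parameters outside [0, 1) receive the identity as default. *)
  have [e01|] := boolP (0 <= e < 1)%R; last by exists 1.
  have [|x x0|x x1|h hE] := @homeo_exists R (kmap e) (5/2); last by exists h.
  - by move=> x y; exact: kmap_slope.
  - by apply: kmap_fix; left.
  - by apply: kmap_fix; right; lra.
pose cl e := iso_class (generated [set (k e)^-1; g]).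
have clP e e' : (0 <= e < 1)%R -> (0 <= e' < 1)%R -> cl e = cl e' ->
    isomorphic (generated [set (k e)^-1; g]) (generated [set (k e')^-1; g]).
  (* The second group belongs to its own class, hence to that of the first. *)
  move=> e01 e'01 ee'; suff [] : cl e (generated [set (k e')^-1; g]) by [].
  rewrite ee'; split; last exact: isomorphic_refl.
  exact: family_square_root.
(* The interval [0, 1) is covered by the fibres of [cl], each countable, so countably many classes
   would make it countable and of Lebesgue measure 0. *)
move=> cnt; have : countable (`[0%R, 1%R[%classic : set R).
  apply: (@sub_countable _ _ _ (\bigcup_(C in square_root_classes R)
      [set e | (0 <= e < 1)%R /\ cl e = C])).
    apply: subset_card_le => e; rewrite /= in_itv /= => e01; exists (cl e) => //.
    by exists (generated [set (k e)^-1; g]) => //; exact: family_square_root.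
  apply: bigcup_countable => // C _.
  apply: (@countable_relators _ _ (fun e => (k e)^-1) (fun=> g));
    move=> e e' [e01 eC] [e'01 e'C].
    by apply: clP; rewrite // eC.
  move=> ww'; case: (ltgtP e e') => // lt_e; exfalso.
    have [||w [w1 w2]] := relators_separate gE kE _ lt_e; try by case/andP: e01 e'01.
      by case/andP: e'01.
    by apply: w2; apply/ww'.
  have [||w [w1 w2]] := relators_separate gE kE _ lt_e; try by case/andP: e'01.
    by case/andP: e01.
  by apply: w2; apply/ww'.
move/countable_lebesgue_measure0; rewrite lebesgue_measure_itv /= lte_fin ltr01.
rewrite oppr0 adde0 => -[]; apply/eqP; exact: oner_neq0.
Qed.
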